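(* For every integer $c\ge2$, there exists an instance (a set of agents, a set of goods, and $\{1,c\}$-SUB valuations for the agents) in which no max Nash welfare allocation is EF1.
   Context: $N=\{1,\dots,n\}$ is a set of agents and $G$ a finite set of goods; agent $i$ has valuation $v_i:2^G\to\mathbb{R}_{\ge0}$. A valuation $v$ is $\{1,c\}$-SUB (bivalued submodular) if $v(\emptyset)=0$; every marginal gain $v(S\cup\{g\})-v(S)$ with $S\subseteq G$, $g\in G\setminus S$ lies in $\{1,c\}$; and $v(S\cup\{g\})-v(S)\ge v(T\cup\{g\})-v(T)$ for all $S\subseteq T\subseteq G$, $g\in G\setminus T$. An allocation $X=(X_0,X_1,\dots,X_n)$ is a partition of $G$ into $n+1$ (possibly empty) bundles; $X_i$ goes to agent $i\in N$ and $X_0$ is the set of unallocated goods. Let $P_X=\{i\in N:v_i(X_i)>0\}$. $X$ is a max Nash welfare allocation if it maximizes $|P_X|$ over all allocations and, subject to that, maximizes $\prod_{i\in P_X}v_i(X_i)$. $X$ is EF1 (envy free up to one good) if for all agents $i,j\in N$ with $X_j\neq\emptyset$ there is a good $g\in X_j$ with $v_i(X_i)\ge v_i(X_j\setminus\{g\})$. *)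

(* Defs.v *)
From mathcomp Require Import all_boot all_order all_algebra.
From mathcomp Require Import reals.

Set Implicit Arguments.
Unset Strict Implicit.
Unset Printing Implicit Defensive.

Import Order.TTheory GRing.Theory Num.Theory.
Local Open Scope ring_scope.

Section Valuations.
Variables (R : realType) (G : finType).
Implicit Types (v : {set G} -> R) (S T : {set G}) (g : G).

Definition marginal v S g : R := v (g |: S) - v S.

Definition bivalued_submodular (c : nat) v : Prop :=
  [/\ forall S, 0 <= v S,
      v set0 = 0,
      forall S g, g \notin S -> marginal v S g = 1 \/ marginal v S g = c%:R
    & forall S T g, S \subset T -> g \notin T ->
        marginal v T g <= marginal v S g].

End Valuations.

Section Allocations.
Variables (R : realType) (n : nat) (G : finType).
Implicit Types (v : 'I_n -> {set G} -> R) (X Y : 'I_n.+1 -> {set G}).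

(* Bundles may be empty, which finset's [partition] forbids. *)
Definition allocation X : Prop :=
  (forall k l, k != l -> [disjoint X k & X l]) /\
  \bigcup_k X k = [set: G].

(* The agents are 'I_n; index [ord0] of X holds the unallocated goods and
   agent i receives the bundle at index i + 1. *)
Definition bundle X (i : 'I_n) : {set G} := X (lift ord0 i).

Definition positive_agents v X : {set 'I_n} := [set i | 0 < v i (bundle X i)].

Definition nash_product v X : R :=
  \prod_(i in positive_agents v X) v i (bundle X i).

Definition max_nash_welfare v X : Prop :=
  [/\ allocation X,
      forall Y, allocation Y ->
        (#|positive_agents v Y| <= #|positive_agents v X|)%N
    & forall Y, allocation Y ->
        #|positive_agents v Y| = #|positive_agents v X| ->
        nash_product v Y <= nash_product v X].

Definition EF1 v X : Prop :=
  forall i j : 'I_n, bundle X j != set0 ->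
    exists2 g, g \in bundle X j & v i (bundle X j :\ g) <= v i (bundle X i).

End Allocations.

(* Main.v *)
Require Import Defs.
From mathcomp Require Import all_boot all_order all_algebra.
From mathcomp Require Import reals.
From mathcomp Require Import zify.

(** Six identical goods and two agents: the first gains [c] from each of its
    first two goods and [1] from any further one, the second always gains [c].
    Among the splits of the six goods, (2, 4) has Nash product [8 c ^ 2], and
    every allocation doing at least as well gives the second agent at least
    two goods more than the first.  As the first agent's value is strictly
    increasing in the number of goods, it still envies the second one after
    the removal of any good. *)

Set Implicit Arguments.
Unset Strict Implicit.
Unset Printing Implicit Defensive.

Import Order.TTheory GRing.Theory Num.Theory.
Local Open Scope ring_scope.

Section CappedValuation.
Local Open Scope nat_scope.

(** Both agents use this formula, with different caps [k]. The truncated [s - k] counts the goods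
    beyond the cap, each worth 1. *)
Definition capped_value (c k s : nat) : nat := c * minn s k + (s - k).

Lemma capped_valueS c k s :
  capped_value c k s.+1 = capped_value c k s + (if s < k then c else 1).
Proof.
by rewrite /capped_value; case: ltnP => hsk; nia.
Qed.

Lemma ltn_capped_value c k : 0 < c -> {homo capped_value c k : s t / s < t}.
Proof.
move=> c_gt0; apply: homo_ltn => [? ? ?|s]; first exact: ltn_trans.
by rewrite capped_valueS; case: ifP => _; lia.
Qed.

End CappedValuation.

(** The marginal depends only on [#|S|]: it is [c] below [k] and 1 from there on. It cannot grow
    with [S] because [1 <= c]. *)
Lemma capped_bivalued_submodular (R : realType) (G : finType) (c k : nat) :
  (0 < c)%N ->
  bivalued_submodular c (fun S : {set G} => (capped_value c k #|S|)%:R : R).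
Proof.
move=> c_gt0.
have marginalE (S : {set G}) g : g \notin S ->
    marginal (fun S : {set G} => (capped_value c k #|S|)%:R : R) S g
    = (if (#|S| < k)%N then c else 1)%:R.
  by move=> gS; rewrite /marginal cardsU1 gS capped_valueS natrD addrAC subrr add0r.
split=> [S||S g gS|S T g sST gT].
- exact: ler0n.
- by rewrite cards0 /capped_value min0n muln0.
- by rewrite marginalE //; case: ifP => _; [right | left].
- have gS : g \notin S by apply: contra gT; apply: (subsetP sST).
  rewrite !marginalE // ler_nat.
  have := subset_leq_card sST.
  by case: (ltnP #|S| k); case: (ltnP #|T| k) => hT hS hST; lia.
Qed.

(** If [b <= a + 1], the largest product occurs at (3, 3). It is [6 c ^ 2 + 3 c], which is below
    [8 c ^ 2] since [c >= 2]. *)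
Lemma nash_split (c a b : nat) :
  (2 <= c)%N -> (a + b <= 6)%N ->
  (8 * c ^ 2 <= capped_value c 2 a * capped_value c 6 b)%N -> (a.+1 < b)%N.
Proof.
move=> hc hab; rewrite /capped_value; apply: contraLR; rewrite -leqNgt -ltnNge => hb.
have -> : minn b 6 = b by lia.
have -> : (b - 6 = 0)%N by lia.
have : (b <= 6)%N by lia.
have : (a <= 6)%N by lia.
(* Only finitely many pairs are left, each giving a quadratic inequality in [c]. *)
move: a b hab hb => [|[|[|[|[|[|[|a]]]]]]] [|[|[|[|[|[|[|b]]]]]]] //= _ _ _ _;
  rewrite /minn /=; nia.
Qed.

(** The (2, 4) split: index 0 is the empty unallocated part, and indices 1 and 2 belong to agents 0
    and 1. *)
Definition split_allocation (k : 'I_3) : {set 'I_6} :=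
  match val k with
  | 0 => set0
  | 1 => [set i : 'I_6 | (i < 2)%N]
  | _ => [set i : 'I_6 | (2 <= i)%N]
  end.

Lemma split_allocationP : allocation split_allocation.
Proof.
split=> [k l|].
  rewrite -setI_eq0 => hkl; apply/eqP/setP => x; move: hkl.
  by case: k l => [[|[|[|k]]] hk] [[|[|[|l]]] hl] //= _;
    rewrite /split_allocation /= !inE //; lia.
apply/setP => x; rewrite inE; apply/bigcupP.
case: (ltnP x 2) => hx.
  by exists (lift ord0 ord0) => //; rewrite /split_allocation /= inE.
by exists (lift ord0 (lift ord0 ord0)) => //; rewrite /split_allocation /= inE.
Qed.

Lemma card_split_allocation :
  #|bundle split_allocation ord0| = 2%N /\
  #|bundle split_allocation (lift ord0 ord0)| = 4%N.
Proof.
by split; rewrite /bundle /split_allocation /= -sum1dep_card big_mkcond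
  !big_ord_recl big_ord0.
Qed.

Lemma card_bundlesD n (G : finType) (X : 'I_n.+1 -> {set G}) (i j : 'I_n) :
  allocation X -> i != j -> (#|bundle X i| + #|bundle X j| <= #|G|)%N.
Proof.
move=> [disjX _] ij; rewrite -cardsUI.
have /eqP -> : bundle X i :&: bundle X j == set0.
  by rewrite setI_eq0; apply: disjX; rewrite (inj_eq lift_inj).
by rewrite cards0 addn0 max_card.
Qed.

Theorem proposition8p1 (R : realType) (c : nat) (hc : (2 <= c)%N) :
  exists (n : nat) (G : finType) (v : 'I_n -> {set G} -> R),
    (forall i : 'I_n, bivalued_submodular c (v i)) /\
    (forall X : 'I_n.+1 -> {set G}, max_nash_welfare v X -> ~ EF1 v X).
Proof.
have c_gt0 : (0 < c)%N by lia.
(* Cap 6 is the number of goods, so the second agent never reaches marginal 1. *)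
pose cap (i : 'I_2) := if i == ord0 then 2%N else 6%N.
pose v (i : 'I_2) (S : {set 'I_6}) : R := (capped_value c (cap i) #|S|)%:R.
exists 2%N, 'I_6, v; split=> [i|X [allocX max_pos max_prod] EF1X].
  exact: capped_bivalued_submodular.
pose j : 'I_2 := lift ord0 ord0.
have [cardY0 cardY1] := card_split_allocation.
have posY : positive_agents v split_allocation = setT.
  apply/setP => i; rewrite !inE /v ltr0n.
  apply: (@leq_ltn_trans (capped_value c (cap i) 0)) => //.
  apply: ltn_capped_value => //.
  case: (unliftP ord0 i) => [k ->|->]; last by rewrite cardY0.
  by rewrite (ord1 k) cardY1.
(* The (2, 4) split makes both agents positive, so a maximizer must too; both Nash products then
   have two factors and can be compared. *)
have posX : positive_agents v X = setT.
  apply/eqP; rewrite eqEcard subsetT /=.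
  by have := max_pos _ split_allocationP; rewrite posY.
have prodE Y : positive_agents v Y = setT ->
    nash_product v Y = (capped_value c 2 #|bundle Y ord0|
                        * capped_value c 6 #|bundle Y j|)%:R.
  move=> posE; rewrite /nash_product posE.
  rewrite (eq_bigl xpredT) => [|i]; last by rewrite inE.
  by rewrite !big_ord_recl big_ord0 mulr1 natrM.
have := max_prod _ split_allocationP; rewrite posY posX => /(_ erefl).
rewrite !prodE // cardY0 cardY1 ler_nat => le_prod.
have card_le : (#|bundle X ord0| + #|bundle X j| <= 6)%N.
  by have := card_bundlesD allocX (isT : ord0 != j); rewrite card_ord.
have gap : (#|bundle X ord0|.+1 < #|bundle X j|)%N.
  apply: (nash_split hc card_le); apply: leq_trans le_prod.
  by rewrite /capped_value /minn /=; nia.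
have Xj_neq0 : bundle X j != set0 by rewrite -card_gt0; lia.
have [g gXj] := EF1X ord0 j Xj_neq0.
(* By [gap], the bundle of [j] without [g] is still strictly larger than that of [ord0]. *)
rewrite /v ler_nat leqNgt => /negP; apply; apply: ltn_capped_value => //.
by have := cardsD1 g (bundle X j); rewrite gXj; lia.
Qed.
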